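(* Let $A$ be a connected artin algebra whose Jacobson radical $\mathbf{r}$ satisfies $\mathbf{r}^2=0$. Then either $A$ is self-injective, or $A$ is CM-free, i.e. every finitely generated Gorenstein-projective left $A$-module is projective.
   Context: $A$ is an artin algebra over a commutative artinian ring $R$; modules are left $A$-modules. A complex $P^\bullet$ of finitely generated projective $A$-modules is totally acyclic if it is acyclic and the complex $\mathrm{Hom}_A(P^\bullet,A)$ is acyclic. A finitely generated $A$-module $M$ is Gorenstein-projective if $M\cong Z^0(P^\bullet)=\mathrm{Ker}(d^0)$ for some totally acyclic complex $P^\bullet$. $A$ is self-injective if ${}_AA$ is an injective module. *)

(* Defs.v *)
From HB Require Import structures.
From mathcomp Require Import all_boot all_algebra.
Set Implicit Arguments. Unset Strict Implicit. Unset Printing Implicit Defensive.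
Import GRing.Theory.
Local Open Scope ring_scope.

Section Modules.
Variable A : pzRingType.

Definition fin_gen (M : lmodType A) : Prop :=
  exists (n : nat) (v : 'I_n -> M),
    forall m : M, exists c : 'I_n -> A, m = \sum_(i < n) c i *: v i.

Definition projective_mod (M : lmodType A) : Prop :=
  forall (N N' : lmodType A) (g : {linear N -> N'}) (f : {linear M -> N'}),
    (forall y : N', exists x : N, g x = y) ->
    exists h : {linear M -> N}, forall m : M, g (h m) = f m.

Definition injective_mod (M : lmodType A) : Prop :=
  forall (N N' : lmodType A) (g : {linear N -> N'}) (f : {linear N -> M}),
    injective g ->
    exists h : {linear N' -> M}, forall n : N, h (g n) = f n.

Definition totally_acyclic (P : int -> lmodType A)
    (d : forall i : int, {linear P i -> P (i + 1)}) : Prop :=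
  [/\ (forall i, fin_gen (P i) /\ projective_mod (P i)),
      (forall (i : int) (x : P (i + 1)),
          d (i + 1) x = 0 <-> exists y : P i, d i y = x) &
      (* exactness of Hom_A(P,A) at Hom(P^(i+1),A):
         Ker (- o d^i) = Im (- o d^(i+1)) *)
      (forall (i : int) (phi : {linear P (i + 1) -> A^o}),
          (forall y : P i, phi (d i y) = 0) <->
          exists psi : {linear P (i + 1 + 1) -> A^o},
            forall x : P (i + 1), phi x = psi (d (i + 1) x))].

Definition gorenstein_projective (M : lmodType A) : Prop :=
  exists (P : int -> lmodType A) (d : forall i : int, {linear P i -> P (i + 1)}),
    totally_acyclic d /\
    exists e : {linear M -> P 0},
      injective e /\
      forall x : P 0, d 0 x = 0 <-> exists m : M, e m = x.

Definition left_ideal (I : A -> Prop) : Prop :=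
  [/\ I 0, (forall x y, I x -> I y -> I (x + y)) & (forall a x, I x -> I (a * x))].

Definition maximal_left_ideal (I : A -> Prop) : Prop :=
  [/\ left_ideal I, ~ I 1 &
      forall J : A -> Prop, left_ideal J -> ~ J 1 ->
        (forall x, I x -> J x) -> forall x, J x -> I x].

Definition jacobson_radical (x : A) : Prop :=
  forall I, maximal_left_ideal I -> I x.

Definition radical_square_zero : Prop :=
  forall x y : A, jacobson_radical x -> jacobson_radical y -> x * y = 0.

Definition connected_ring : Prop :=
  (1 : A) <> 0 /\
  forall e : A, e * e = e -> (forall a : A, e * a = a * e) -> e = 0 \/ e = 1.

Definition self_injective : Prop := injective_mod A^o.

Definition CM_free : Prop :=
  forall M : lmodType A, fin_gen M -> gorenstein_projective M -> projective_mod M.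

End Modules.

Definition ideal_of (R : comPzRingType) (I : R -> Prop) : Prop :=
  [/\ I 0, (forall x y, I x -> I y -> I (x + y)) & (forall a x, I x -> I (a * x))].

Definition artinian_ring (R : comPzRingType) : Prop :=
  forall I : nat -> R -> Prop,
    (forall n, ideal_of (I n)) ->
    (forall n x, I n.+1 x -> I n x) ->
    exists N : nat, forall n, (N <= n)%N -> forall x, I n x <-> I N x.

Definition artin_algebra (R : comPzRingType) (A : algType R) : Prop :=
  artinian_ring R /\ fin_gen (A : lmodType R).

(* Main.v *)
Require Import Defs.
From HB Require Import structures.
From mathcomp Require Import all_boot all_algebra.
From mathcomp Require Import boolp classical_sets.
Set Implicit Arguments. Unset Strict Implicit. Unset Printing Implicit Defensive.
Import GRing.Theory.
Local Open Scope ring_scope.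

(** Let [r] be the radical and [P] a totally acyclic complex with [M] as its
    zeroth kernel.  Let [I] be the annihilator of the cohomology of [P / rP] and
    [J] its complement modulo [r], so that [I + J = A] and [IJ], [JI] lie in [r].
    The connecting map identifies the cohomology of [P / rP] with that of [rP],
    shifted by one; this gives [I r J = 0], and lifting maps along the complex
    [Hom(P, A)] gives [J r I = 0].  Hence lifting the decomposition [1 = i + j]
    yields a central idempotent in [J], which is [0] or [1].  If it is [0], then
    [P / rP] is acyclic, [P] is contractible and [M] is projective.  If it is [1],
    every simple module occurs in the cohomology of [P / rP], so that acyclicity
    of [Hom(P, A)] gives Baer's criterion for maximal left ideals.

    Passing to a minimal complex is avoided by means of a quasi-inverse [rho] of
    the differential modulo [r], i.e. [(d - d rho d) P] lies in [rP]. *)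

(** [Zorn_bigcup] also asks for the union of the empty chain, so the empty set is adjoined to [P];
    [X0] then rules out a spurious empty maximum. *)
Lemma Zorn_above_bigcup (T : Type) (P : set (set T)) (X0 : set T) :
  P X0 ->
  (forall F : set (set T), (F `<=` P)%classic -> (exists X, F X) ->
     total_on F subset -> P (\bigcup_(X in F) X)%classic) ->
  exists2 X, P X & forall Y, P Y -> (X `<=` Y)%classic -> (Y `<=` X)%classic.
Proof.
move=> PX0 chainP.
have [|X [PX maxX]] := @Zorn_bigcup T (fun X => P X \/ X = set0).
  move=> F FP Ftot; pose F' : set (set T) := fun X => F X /\ P X.
  have eqF : (\bigcup_(X in F) X)%classic = (\bigcup_(X in F') X)%classic.
    apply/seteqP; split=> x [X FX Xx]; last by exists X => //; case: FX.
    exists X => //; split=> //; case: (FP X FX) => // X0x.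
    by rewrite X0x in Xx.
  have [[X F'X]|noF'] := pselect (exists X, F' X).
    left; rewrite eqF; apply: chainP; first by move=> Y [].
      by exists X.
    by move=> Y Z [FY _] [FZ _]; exact: Ftot.
  right; rewrite eqF; apply/seteqP; split=> // x [X F'X _].
  by apply: noF'; exists X.
have PX' : P X.
  case: PX => // X0x; have [X0e|X0n] := pselect (X0 `<=` set0)%classic.
    by rewrite X0x (_ : set0 = X0) //; apply/seteqP; split.
  by case: (maxX X0); [rewrite X0x; split=> // | left].
exists X => // Y PY XY; apply: contrapT => YX.
by apply: (maxX Y); [split | left].
Qed.

(** * Submodules, descending chains and maximal left ideals *)

Section Submodules.
Variable A : pzRingType.

Definition submod (M : lmodType A) (N : M -> Prop) : Prop :=
  [/\ N 0, forall x y, N x -> N y -> N (x + y) & forall a x, N x -> N (a *: x)].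

Definition artinian_mod (M : lmodType A) : Prop :=
  forall N : nat -> M -> Prop,
    (forall n, submod (N n)) -> (forall n x, N n.+1 x -> N n x) ->
    exists k, forall n, (k <= n)%N -> forall x, N n x <-> N k x.

Lemma submodN (M : lmodType A) (N : M -> Prop) x : submod N -> N x -> N (- x).
Proof. by case=> _ _ NZ Nx; rewrite -scaleN1r; exact: NZ. Qed.

Lemma submodB (M : lmodType A) (N : M -> Prop) x y :
  submod N -> N x -> N y -> N (x - y).
Proof. by move=> sN Nx Ny; case: (sN) => _ ND _; apply: ND => //; exact: submodN. Qed.

Fixpoint in_span (M : lmodType A) (s : seq M) (x : M) : Prop :=
  if s is v :: s' then exists a w, in_span s' w /\ x = a *: v + w else x = 0.

Lemma submod_span (M : lmodType A) (s : seq M) : submod (in_span s).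
Proof.
elim: s => [|v s [s0 sD sZ]] /=.
  by split=> [//|x y -> ->|a x ->]; rewrite ?addr0 ?scaler0.
split=> [|_ _ [a [w [sw ->]]] [b [z [sz ->]]]|c _ [a [w [sw ->]]]].
- by exists 0, 0; rewrite scale0r addr0.
- by exists (a + b), (w + z); rewrite scalerDl addrACA; split=> //; exact: sD.
- by exists (c * a), (c *: w); rewrite scalerDr scalerA; split=> //; exact: sZ.
Qed.

Lemma chain_antimono (M : lmodType A) (N : nat -> M -> Prop) :
  (forall n x, N n.+1 x -> N n x) ->
  forall m n x, (m <= n)%N -> N n x -> N m x.
Proof.
move=> Ndec m n x /subnK <-; elim: (n - m)%N => [//|k IH].
by rewrite addSn => /Ndec.
Qed.

(** Two chains stabilize: the traces on the span of [s], and the left ideals [L n] of coefficients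
    of [v]. Nested submodules with equal traces and equal coefficients agree on the span of
    [v :: s]. *)
Lemma artinian_span (M : lmodType A) (s : seq M) :
  artinian_mod A^o ->
  forall N : nat -> M -> Prop,
    (forall n, submod (N n)) -> (forall n x, N n.+1 x -> N n x) ->
    exists k, forall n, (k <= n)%N ->
      forall x, in_span s x -> N k x -> N n x.
Proof.
move=> artA; elim: s => [|v s IH] N sN Ndec.
  by exists 0%N => n _ x /= -> _; case: (sN n).
have [k1 Hk1] := IH N sN Ndec.
pose L n (a : A) := exists2 w, in_span s w & N n (a *: v + w).
have [sp0 spD spZ] := submod_span s.
have [||k2 Hk2] := artA L.
- move=> n; case: (sN n) => N0 ND NZ; split=> [|a b [w sw Nw] [z sz Nz]|a b [w sw Nw]].
  + by exists 0 => //; rewrite scale0r addr0.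
  + by exists (w + z); [exact: spD | rewrite scalerDl addrACA; exact: ND].
  + by exists (a *: w); [exact: spZ | rewrite -scalerA -scalerDr; exact: NZ].
- by move=> n a [w sw Nw]; exists w => //; exact: Ndec.
exists (maxn k1 k2) => n; rewrite geq_max => /andP[le1 le2] _ [a [w [sw ->]]] Nx.
have /(Hk2 n le2)[w' sw' Nx'] : L k2 a.
  by exists w => //; apply: chain_antimono Nx => //; exact: leq_maxr.
have -> : a *: v + w = (a *: v + w') + (w - w').
  by rewrite addrACA subrr addr0.
have [_ ND _] := sN n; apply: ND => //; apply: Hk1 => //.
  exact: submodB (submod_span s) sw sw'.
have -> : w - w' = (a *: v + w) - (a *: v + w').
  by rewrite opprD addrACA subrr add0r.
apply: submodB => //; first by apply: chain_antimono Nx => //; exact: leq_maxl.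
exact: chain_antimono Nx'.
Qed.

Lemma fin_gen_span (M : lmodType A) :
  fin_gen M -> exists s : seq M, forall x, in_span s x.
Proof.
move=> [n [v Hv]]; exists (codom v) => x; have [c ->] := Hv x.
rewrite -big_enum /= /codom /image_mem; elim: (enum 'I_n) => [|i s IH] /=.
  by rewrite big_nil.
by rewrite big_cons; exists (c i), (\sum_(j <- s) c j *: v j).
Qed.

Lemma artinian_fin_gen (M : lmodType A) :
  artinian_mod A^o -> fin_gen M -> artinian_mod M.
Proof.
move=> artA /fin_gen_span[s Hs] N sN Ndec.
have [k Hk] := artinian_span s artA sN Ndec.
exists k => n le_kn x; split; last exact: Hk.
exact: chain_antimono.
Qed.

Lemma artinian_minimal (M : lmodType A) (F : (M -> Prop) -> Prop) (N0 : M -> Prop) :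
  artinian_mod M -> submod N0 -> F N0 ->
  exists N, [/\ submod N, F N &
    forall N', submod N' -> F N' -> (forall x, N' x -> N x) -> forall x, N x -> N' x].
Proof.
move=> artM sN0 FN0; apply: contrapT => noN.
pose T := {N : M -> Prop | submod N /\ F N}.
have step (N : T) : exists N' : T,
    (forall x, sval N' x -> sval N x) /\ exists x, sval N x /\ ~ sval N' x.
  case: N => N [sN FN] /=; apply: contrapT => noN'; apply: noN; exists N; split=> //.
  move=> N' sN' FN' N'N x Nx; apply: contrapT => nN'x; apply: noN'.
  by exists (exist _ N' (conj sN' FN')); split=> //; exists x.
have [f Hf] := choice step.
pose g n := iter n f (exist _ N0 (conj sN0 FN0)); pose G n := sval (g n).
have [||k Hk] := artM G.
- by move=> n; rewrite /G; case: (g n) => N [].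
- by move=> n x; have [H _] := Hf (g n); exact: H.
have [_ [x [Gx nGx]]] := Hf (g k).
by apply: nGx; apply/(Hk k.+1 (leqnSn k) x).
Qed.

Lemma artinian_minimal_ideal (F : (A -> Prop) -> Prop) (L0 : A -> Prop) :
  artinian_mod A^o -> left_ideal L0 -> F L0 ->
  exists L, [/\ left_ideal L, F L &
    forall L', left_ideal L' -> F L' -> (forall x, L' x -> L x) ->
      forall x, L x -> L' x].
Proof. exact: (@artinian_minimal A^o). Qed.

Lemma maximal_above (L : A -> Prop) :
  left_ideal L -> ~ L 1 ->
  exists2 n, maximal_left_ideal n & forall x, L x -> n x.
Proof.
move=> lL nL1.
have [||n [ln nn1 Ln] maxn] :=
  @Zorn_above_bigcup A (fun X => [/\ left_ideal X, ~ X 1 & forall x, L x -> X x]) L.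
- by split.
- move=> F FP [X0 FX0] Ftot; have [[X00 _ _] _ LX0] := FP _ FX0; split.
  + split; first by exists X0.
      move=> x y [X FX Xx] [Y FY Yy].
      case: (Ftot X Y FX FY) => sub; [exists Y => // | exists X => //].
        by have [[_ YD _] _ _] := FP _ FY; apply: YD => //; exact: sub.
      by have [[_ XD _] _ _] := FP _ FX; apply: XD => //; exact: sub.
    by move=> a x [X FX Xx]; exists X => //; have [[_ _ XZ] _ _] := FP _ FX; exact: XZ.
  + by case=> X /FP[].
  + by move=> x /LX0 X0x; exists X0.
exists n => //; split=> // J lJ nJ1 nJ; apply: maxn => //.
by split=> // x /Ln /nJ.
Qed.

(** The left ideal [n + A x] strictly contains [n], hence contains 1. *)
Lemma maximal_inv (n : A -> Prop) x :
  maximal_left_ideal n -> ~ n x -> exists a, n (1 - a * x).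
Proof.
move=> [[n0 nD nZ] nn1 maxn] nnx; apply: contrapT => noa.
have H := maxn (fun y => exists a, n (y - a * x)).
apply: nnx; apply: H.
- split=> [|y z [a na] [b nb]|c y [a na]].
  + by exists 0; rewrite mul0r subr0.
  + by exists (a + b); rewrite mulrDl opprD addrACA; exact: nD.
  + by exists (c * a); rewrite -mulrA -mulrBr; exact: nZ.
- by [].
- by move=> y ny; exists 0; rewrite mul0r subr0.
- by exists 1; rewrite mul1r subrr.
Qed.

Lemma maximal_of_inv (n : A -> Prop) :
  left_ideal n -> ~ n 1 -> (forall x, ~ n x -> exists a, n (1 - a * x)) ->
  maximal_left_ideal n.
Proof.
move=> ln nn1 inv; split=> // J [J0 JD JZ] nJ1 nJ x Jx; apply: contrapT => /inv[a na].
by apply: nJ1; rewrite -(subrK (a * x) 1); apply: JD; [exact: nJ | exact: JZ].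
Qed.

Lemma maximal_not1 (n : A -> Prop) x : maximal_left_ideal n -> n (1 - x) -> ~ n x.
Proof.
by move=> [[_ nD _] nn1 _] n1x nx; apply: nn1; rewrite -(subrK x 1); exact: nD.
Qed.

(* The point [l *: y] generates a simple submodule of [M / K]: take [l] in a
   left ideal minimal among those not mapping [y] into [K]. *)
Lemma simple_below (M : lmodType A) (K : M -> Prop) (y : M) :
  artinian_mod A^o -> submod K -> ~ K y ->
  exists l, ~ K (l *: y) /\ maximal_left_ideal (fun a => K (a *: (l *: y))).
Proof.
move=> artA [K0 KD KZ] nKy.
have [||L [[L0 LD LZ] [l [Ll nKl]] minL]] :=
  @artinian_minimal_ideal (fun L => exists l, L l /\ ~ K (l *: y)) (fun=> True) artA.
- by split.
- by exists 1; rewrite scale1r.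
exists l; split=> //; apply: maximal_of_inv; last 2 first.
- by rewrite scale1r.
- move=> a nKal.
  (* [A a l] lies in [L] and does not send [y] into [K], so by minimality it contains [l]; the
     coefficient [c] inverts [a]. *)
  have [|||c Hc] := minL (fun x => exists c, x = c * (a * l)) _ _ _ _ Ll.
  + split=> [|x z [c ->] [c' ->]|c x [c' ->]].
    * by exists 0; rewrite mul0r.
    * by exists (c + c'); rewrite mulrDl.
    * by exists (c * c'); rewrite -mulrA.
  + by exists (a * l); rewrite -scalerA; split=> //; exists 1; rewrite mul1r.
  + by move=> x [c ->]; rewrite mulrA; exact: LZ.
  by exists c; rewrite scalerA mulrBl mul1r -mulrA -Hc subrr scale0r.
split=> [|a b Ka Kb|a b Kb]; first by rewrite scale0r.
  by rewrite scalerDl; exact: KD.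
by rewrite -scalerA; exact: KZ.
Qed.

End Submodules.

(** * The Jacobson radical and simple modules *)

Section Radical.
Variable A : pzRingType.
Local Notation jac := (@jacobson_radical A).

Lemma jac_ideal : left_ideal jac.
Proof.
split=> [I [[]]//|x y rx ry I mI|a x rx I mI]; have [[_ ID IZ] _ _] := mI.
  by apply: ID; [exact: rx | exact: ry].
by apply: IZ; exact: rx.
Qed.

Lemma jacMl a x : jac x -> jac (a * x).
Proof. by case: jac_ideal => _ _; exact. Qed.

Lemma jacD x y : jac x -> jac y -> jac (x + y).
Proof. by case: jac_ideal => _ H _; exact: H. Qed.

(** For [a] outside [n], the elements [b] with [b a] in [n] form the annihilator of a generator of
    the simple module [A / n], again a maximal left ideal. *)
Lemma jacMr a x : jac x -> jac (x * a).
Proof.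
move=> rx n mn; have [[n0 nD nZ] nn1 _] := mn.
have [na|nna] := pselect (n a); first exact: nZ.
apply: (rx (fun b => n (b * a))); apply: maximal_of_inv.
- split=> [|b c nb nc|b c nc]; first by rewrite mul0r.
    by rewrite mulrDl; exact: nD.
  by rewrite -mulrA; exact: nZ.
- by rewrite mul1r.
- move=> b /(maximal_inv mn)[c nc]; exists (a * c).
  by rewrite mulrBl mul1r -[X in X - _]mulr1 -!mulrA -mulrBr; exact: nZ.
Qed.

Lemma jac_semiprime u : (forall a, jac (u * a * u)) -> jac u.
Proof.
move=> rua n mn; have [[n0 nD nZ] nn1 _] := mn; apply: contrapT => nnu.
have [a na] := maximal_inv mn nnu; apply: nnu.
have -> : u = u * (1 - a * u) + u * a * u by rewrite mulrBr mulr1 mulrA subrK.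
by apply: nD; [exact: nZ | exact: rua].
Qed.

(* [A w] is a left ideal minimal among those not contained in [n], normalized
   so that [w] is congruent to [1]. *)
Lemma maximal_complement (n : A -> Prop) :
  artinian_mod A^o -> maximal_left_ideal n ->
  exists w, [/\ n (1 - w), forall a, n a -> jac (a * w) &
                forall a, n (a * w) -> jac (a * w)].
Proof.
move=> artA mn; have [[n0 nD nZ] nn1 _] := mn.
have [||L [[L0 LD LZ] [l [Ll nnl]] minL]] :=
  @artinian_minimal_ideal A (fun L => exists l, L l /\ ~ n l) (fun=> True) artA.
- by split.
- by exists 1.
(* If [t] avoids [m'], then [1 - b t] is in [m'] for some [b], and [l (1 - b t)] is in [L] and [m']
   but not in [n]. Minimality then puts [L], and so [t], inside [m']. *)
have Lr t : L t -> n t -> jac t.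
  move=> Lt nt m' mm'; have [[m0 mD mZ] _ _] := mm'; apply: contrapT => nmt.
  have [b mb] := maximal_inv mm' nmt.
  have Lc : L (l * (1 - b * t)).
    rewrite mulrBr mulr1 -(mulN1r (l * _)); apply: (LD) => //; apply: (LZ).
    by apply: (LZ); apply: (LZ).
  have [nc|nnc] := pselect (n (l * (1 - b * t))).
    apply: nnl; have -> : l = l * (1 - b * t) + l * (b * t).
      by rewrite mulrBr mulr1 subrK.
    by apply: nD => //; apply: (nZ); exact: nZ.
  have [|||_ mt] := minL (fun x => L x /\ m' x) _ _ _ _ Lt.
  - by split=> [|x y [Lx mx] [Ly my]|a x [Lx mx]]; split=> //;
      [exact: LD | exact: mD | exact: LZ | exact: mZ].
  - by exists (l * (1 - b * t)); split=> //; split=> //; exact: mZ.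
  - by move=> x [].
  exact: nmt.
have [a na] := maximal_inv mn nnl.
have La : L (a * l) by exact: LZ.
exists (a * l); split=> // b nb; last by apply: Lr => //; exact: LZ.
apply: Lr; first exact: LZ.
have -> : b * (a * l) = b - b * (1 - a * l) by rewrite mulrBr mulr1 opprB addrC subrK.
by apply: (submodB (M := A^o)) => //; exact: nZ.
Qed.

(* The simple module [A / n] is isomorphic to [(A u + jac) / jac], whose
   endomorphism ring is a division ring. *)
Lemma right_inverse_mod (n : A -> Prop) u :
  maximal_left_ideal n -> (forall a, n a -> jac (a * u)) -> ~ jac u ->
  exists c, n (u * c - 1).
Proof.
move=> mn nur nru; have [[n0 nD nZ] nn1 maxn] := mn.
have ker_u a : jac (a * u) -> n a.
  apply: (maxn (fun a => jac (a * u))) => //; last by rewrite mul1r.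
  split=> [|x y rx ry|x y ry]; rewrite ?mul0r ?mulrDl -?mulrA.
  - by case: jac_ideal.
  - exact: jacD.
  - exact: jacMl.
have [c nuc] : exists c, ~ n (u * c).
  apply: contrapT => noc; apply: nru; apply: jac_semiprime => c; apply: nur.
  by apply: contrapT => nuc; apply: noc; exists c.
set v := u * c in nuc.
have nv a : n a -> n (a * v).
  by move=> na; rewrite mulrA; apply: (jacMr c (nur a na)).
have ker_v a : n (a * v) -> n a.
  apply: (maxn (fun a => n (a * v))) => //; last by rewrite mul1r.
  split=> [|x y rx ry|x y ry]; rewrite ?mul0r ?mulrDl -?mulrA //.
    exact: nD.
  exact: nZ.
(* The left inverse [b] of [v] modulo [n] is also a right inverse: [(v b - 1) v = - v (1 - b v)]
   lies in [n], and [ker_v] cancels [v]. *)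
have [b nb] := maximal_inv mn nuc; exists (c * b); apply: ker_v.
rewrite mulrA -/v mulrBl mul1r -(opprB v) -[X in - (X - _)]mulr1 -mulrA -mulrBr.
by apply: (submodN (M := A^o)) => //; exact: nZ.
Qed.

End Radical.

(** * The radical of a projective module, and quasi-inverses modulo it *)

Section RadicalOfModules.
Variable A : pzRingType.
Local Notation jac := (@jacobson_radical A).

Definition linear_of (U V : lmodType A) (f : U -> V) (lin_f : linear f) :
  {linear U -> V} := HB.pack f (GRing.isLinear.Build A U V *:%R f lin_f).

(** This is [rM], built as finite sums so that its elements can be treated by induction. *)
Inductive rad_mod (M : lmodType A) : M -> Prop :=
| rad_mod0 : rad_mod 0
| rad_modS s p x : jac s -> rad_mod x -> rad_mod (s *: p + x).

Lemma rad_modZ (M : lmodType A) s (p : M) : jac s -> rad_mod (s *: p).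
Proof. by move=> rs; rewrite -[_ *: _]addr0; apply: rad_modS => //; constructor. Qed.

Lemma submod_rad (M : lmodType A) : submod (@rad_mod M).
Proof.
split; first by constructor.
  move=> x y rx ry; elim: rx => [|s p z rs rz IH]; first by rewrite add0r.
  by rewrite -addrA; constructor.
move=> a x; elim=> [|s p z rs rz IH]; first by rewrite scaler0; constructor.
by rewrite scalerDr scalerA; constructor => //; exact: jacMl.
Qed.

Lemma rad_modD (M : lmodType A) (x y : M) : rad_mod x -> rad_mod y -> rad_mod (x + y).
Proof. by case: (submod_rad M) => _ H _; exact: H. Qed.

Lemma rad_modB (M : lmodType A) (x y : M) : rad_mod x -> rad_mod y -> rad_mod (x - y).
Proof. by apply: submodB; exact: submod_rad. Qed.

Lemma rad_mod_scale (M : lmodType A) a (x : M) : rad_mod x -> rad_mod (a *: x).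
Proof. by case: (submod_rad M) => _ _; exact. Qed.

Lemma rad_mod_map (M N : lmodType A) (f : {linear M -> N}) x :
  rad_mod x -> rad_mod (f x).
Proof.
elim=> [|s p z rs rz IH]; first by rewrite linear0; constructor.
by rewrite linearD linearZ; constructor.
Qed.

Lemma rad_mod_form (M : lmodType A) (f : {linear M -> A^o}) x :
  rad_mod x -> jac (f x).
Proof.
elim=> [|s p z rs rz IH]; first by rewrite linear0; case: (@jac_ideal A).
rewrite linearD linearZ; apply: jacD => //; exact: jacMr.
Qed.

(** The [phi i] are the coordinates of a section of the surjection from [A^n] onto [Q]. *)
Lemma dual_basis (Q : lmodType A) : fin_gen Q -> projective_mod Q ->
  exists (n : nat) (v : 'I_n -> Q) (phi : 'I_n -> {linear Q -> A^o}),
    forall q, q = \sum_i (phi i q : A) *: v i.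
Proof.
move=> [n [v Hv]] projQ.
have lin_g : linear (fun c : 'rV[A]_n => \sum_i c 0 i *: v i).
  move=> a c c'; rewrite scaler_sumr -big_split /=; apply: eq_bigr => i _.
  by rewrite !mxE scalerDl scalerA.
have [|h Hh] := projQ _ _ (linear_of lin_g) (linear_of (fun a (x y : Q) => erefl (a *: x + y))).
  move=> y; have [c ->] := Hv y; exists (\row_i c i) => /=.
  by apply: eq_bigr => i _; rewrite mxE.
have lin_phi i : linear (fun q => h q 0 i : A^o).
  by move=> a x y; rewrite linearP !mxE.
by exists n, v, (fun i => linear_of (lin_phi i)) => q; rewrite -[LHS]Hh.
Qed.

Hypothesis artA : artinian_mod A^o.

(** In a dual basis some coordinate of [q] is outside r; right multiplication by its inverse modulo
    [n] normalizes it. *)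
Lemma separating_form (Q : lmodType A) (n : A -> Prop) (q : Q) :
  fin_gen Q -> projective_mod Q -> maximal_left_ideal n ->
  ~ rad_mod q -> (forall a, n a -> rad_mod (a *: q)) ->
  exists phi : {linear Q -> A^o}, n (phi q - 1).
Proof.
move=> fgQ projQ mn nrq nq; have [k [v [phi Hphi]]] := dual_basis fgQ projQ.
have [i nri] : exists i, ~ jac (phi i q).
  apply: contrapT => noi; apply: nrq; rewrite (Hphi q).
  apply: (big_ind (@rad_mod Q)); [by constructor | exact: rad_modD | move=> i _].
  by apply: rad_modZ; apply: contrapT => nri; apply: noi; exists i.
have [|c nc] := right_inverse_mod mn _ nri.
  move=> a na; have := rad_mod_form (phi i) (nq a na).
  by rewrite linearZ.
have lin_c : linear (fun z => (phi i z : A) * c : A^o).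
  by move=> a x y; rewrite linearP /= mulrDl -!mulrA.
by exists (linear_of lin_c).
Qed.

(* A map between the semisimple modules [P / rad P] and [Q / rad Q] has a
   quasi-inverse.  If [rho] is not yet one, its defect [d - d rho d] is reduced
   by splitting off a simple submodule of its image. *)
Lemma quasi_inverse (P Q : lmodType A) (d : {linear P -> Q}) :
  fin_gen Q -> projective_mod Q ->
  exists rho : {linear Q -> P}, forall p, rad_mod (d p - d (rho (d p))).
Proof.
move=> fgQ projQ.
have artQ := artinian_fin_gen artA fgQ.
have lin0 : linear ((fun=> 0) : Q -> P) by move=> a x y; rewrite scaler0 addr0.
have [||N [[N0 ND NZ] [rho Hrho] minN]] := @artinian_minimal _ Q
  (fun N => exists rho : {linear Q -> P}, forall p, N (d p - d (rho (d p))))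
  (fun=> True) artQ.
- by split.
- by exists (linear_of lin0).
exists rho; apply: contrapT => /existsNP[p0 nr0].
set y := d p0 - _ in nr0.
have [l [nrq mn]] := simple_below artA (submod_rad Q) nr0.
have [phi] := separating_form fgQ projQ mn nrq (fun a => id).
set q := l *: y in nrq mn *.
move=> nphi; pose p1 := l *: p0; pose D p := d p - d (rho (d p)).
have Eq : D p1 = q by rewrite /D /p1 linearZ /= linearZ /= linearZ /= -scalerBr.
have Nq : N q by apply: (NZ); exact: Hrho.
(* As [d (p1 - rho (d p1)) = q], this correction of [rho] turns the defect [D p] into
   [D p - phi (D p) q]. *)
have lin_rho' : linear (fun z => rho z + (phi (z - d (rho z)) : A) *: (p1 - rho (d p1))).
  move=> a z z'; rewrite (linearP rho) (linearP d).
  have -> : a *: z + z' - (a *: d (rho z) + d (rho z')) =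
            a *: (z - d (rho z)) + (z' - d (rho z')).
    by rewrite scalerBr opprD addrACA.
  rewrite (linearP phi) /=; move: (p1 - _) => v1.
  by rewrite scalerDl (scalerDr a (rho z)) scalerA addrACA.
have Drho' p : d p - d (linear_of lin_rho' (d p)) = D p - (phi (D p) : A) *: q.
  by rewrite -Eq /= linearD linearZ /= [d (p1 - _)]linearB opprD addrA.
have [n0 nD nZ] : left_ideal (fun a => rad_mod (a *: q)) by case: mn.
have lphi a (x y' : Q) : phi (a *: x + y') = (a * phi x + phi y' :> A) by exact: linearP.
(* This submodule contains the new defects, because [phi q - 1] is in [n] and [n] kills [q] modulo
   the radical. It misses [q], because there [phi q] acts on [q] as 1. *)
have [|||_] := minN (fun z => N z /\ rad_mod ((phi z : A) *: q)) _ _ _ q Nq.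
- split.
  + by split=> //; rewrite linear0 scale0r; constructor.
  + by move=> x z [Nx rx] [Nz rz]; split; [exact: ND | rewrite linearD; exact: nD].
  + by move=> a x [Nx rx]; split; [exact: NZ | rewrite linearZ; exact: nZ].
- exists (linear_of lin_rho') => p; rewrite Drho'; split.
    by apply: submodB => //; [exact: Hrho | exact: NZ].
  rewrite -scaleNr addrC lphi.
  have -> : - phi (D p) * phi q + phi (D p) = - phi (D p) * (phi q - 1) :> A.
    by rewrite mulrBr mulr1 opprK.
  exact: nZ.
- by move=> z [].
move=> rq; apply: nrq.
have -> : q = (phi q : A) *: q - (phi q - 1 : A) *: q.
  by rewrite -scalerBl opprB addrC subrK scale1r.
exact: rad_modB.
Qed.

End RadicalOfModules.

(** * The cohomology of [P / rP] and its annihilator *)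

Section TotallyAcyclic.
Variable A : pzRingType.
Hypothesis artA : artinian_mod A^o.
Hypothesis rad2 : radical_square_zero A.
Local Notation jac := (@jacobson_radical A).

Lemma rad_mod_kill (M : lmodType A) s (x : M) : jac s -> rad_mod x -> s *: x = 0.
Proof.
move=> rs; elim=> [|t p z rt _ IH]; first by rewrite scaler0.
by rewrite scalerDr IH addr0 scalerA rad2 // scale0r.
Qed.

(** The map [d - d rho d] has values in [rQ], so it sends [rP] into [r (rQ) = 0]. *)
Lemma defect_kill (P Q : lmodType A) (d : {linear P -> Q}) (rho : {linear Q -> P}) x :
  (forall p, rad_mod (d p - d (rho (d p)))) -> rad_mod x ->
  d x = d (rho (d x)).
Proof.
move=> Hrho; elim=> [|s p z rs _ IH]; first by rewrite !linear0.
rewrite !linearD /= -IH; congr (_ + _); apply/eqP; rewrite -subr_eq0; apply/eqP.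
rewrite linearZ /= linearZ /= linearZ /= -scalerBr.
exact: rad_mod_kill.
Qed.

Variables (P : int -> lmodType A) (d : forall i : int, {linear P i -> P (i + 1)}).
Hypothesis totP : totally_acyclic d.

Let fgP i : fin_gen (P i). Proof. by case: totP => /(_ i)[]. Qed.
Let projP i : projective_mod (P i). Proof. by case: totP => /(_ i)[]. Qed.
Let exactP i (x : P (i + 1)) : d (i + 1) x = 0 <-> exists y, d i y = x.
Proof. by case: totP => _ /(_ i x). Qed.
Let dd i (y : P i) : d (i + 1) (d i y) = 0. Proof. by apply/exactP; exists y. Qed.
Let qinvP i : exists rho : {linear P (i + 1) -> P i},
  forall p, rad_mod (d i p - d i (rho (d i p))).
Proof. exact: quasi_inverse. Qed.

(* [top_cycle / top_boundary] is the cohomology of the complex [P / rad P]. *)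
Definition top_cycle i (x : P i) : Prop := rad_mod (d i x).
(** By exactness [Ker d] is the image of the preceding differential; the kernel avoids an index
    [i - 1]. *)
Definition top_boundary i (x : P i) : Prop :=
  exists z y, [/\ d i z = 0, rad_mod y & x = z + y].
Definition top_ann (a : A) : Prop :=
  forall i (x : P i), top_cycle x -> top_boundary (a *: x).

(* Modulo the radical, the complement of the two-sided ideal [top_ann]. *)
Definition top_coann (a : A) : Prop := forall b, top_ann b -> jac (b * a).

Lemma submod_top_boundary i : submod (@top_boundary i).
Proof.
split.
- by exists 0, 0; rewrite linear0 addr0; split=> //; constructor.
- move=> _ _ [z [y [dz ry ->]]] [z' [y' [dz' ry' ->]]].
  exists (z + z'), (y + y'); rewrite linearD dz dz' addr0 addrACA; split=> //.
  exact: rad_modD.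
- move=> a _ [z [y [dz ry ->]]]; exists (a *: z), (a *: y).
  by rewrite linearZ /= dz scaler0 scalerDr; split=> //; exact: rad_mod_scale.
Qed.

Lemma rad_top_boundary i (x : P i) : rad_mod x -> top_boundary x.
Proof. by exists 0, x; rewrite linear0 add0r. Qed.

Lemma top_cycleZ i a (x : P i) : top_cycle x -> top_cycle (a *: x).
Proof. by rewrite /top_cycle linearZ; exact: rad_mod_scale. Qed.

Lemma top_ann_ideal : left_ideal top_ann.
Proof.
split.
- by move=> i x _; rewrite scale0r; case: (submod_top_boundary i).
- move=> a b Ia Ib i x Bx; rewrite scalerDl.
  by case: (submod_top_boundary i) => _ H _; apply: H; [exact: Ia | exact: Ib].
- move=> a b Ib i x Bx; rewrite -scalerA.
  by case: (submod_top_boundary i) => _ _; apply; exact: Ib.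
Qed.

Lemma top_annMr a b : top_ann a -> top_ann (a * b).
Proof. by move=> Ia i x Bx; rewrite -scalerA; exact/Ia/top_cycleZ. Qed.

Lemma top_coann_ideal : left_ideal top_coann.
Proof.
split.
- by move=> b _; rewrite mulr0; case: (@jac_ideal A).
- by move=> x y Jx Jy b Ib; rewrite mulrDr; apply: jacD; [exact: Jx | exact: Jy].
- by move=> a x Jx b Ib; rewrite mulrA; apply: Jx; exact: top_annMr.
Qed.

Lemma top_coannMr a b : top_coann a -> top_coann (a * b).
Proof. by move=> Ja c Ic; rewrite mulrA; apply: jacMr; exact: Ja. Qed.

(** The definition only gives that IJ lies in r; the order is reversed by semiprimeness, since
    [b c a] is in IJ. *)
Lemma top_coann_ann a b : top_coann a -> top_ann b -> jac (a * b).
Proof.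
move=> Ja Ib; apply: jac_semiprime => c.
have -> : a * b * c * (a * b) = a * (b * c * a) * b by rewrite !mulrA.
by apply: jacMr; apply: jacMl; apply: Ja; exact: top_annMr.
Qed.

Lemma ideals_comaximal (I J : A -> Prop) : left_ideal I -> left_ideal J ->
  (forall n, maximal_left_ideal n -> (forall x, I x -> n x) ->
     (forall x, J x -> n x) -> False) ->
  exists x y, [/\ I x, J y & 1 = x + y].
Proof.
move=> [I0 ID IZ] [J0 JD JZ] Hn; apply: contrapT => noxy.
have [||n mn IJn] := @maximal_above A (fun c => exists x y, [/\ I x, J y & c = x + y]).
- split.
  + by exists 0, 0; rewrite addr0.
  + move=> _ _ [x [y [Ix Jy ->]]] [x' [y' [Ix' Jy' ->]]].
    by exists (x + x'), (y + y'); rewrite addrACA; split; [exact: ID | exact: JD |].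
  + move=> a _ [x [y [Ix Jy ->]]]; exists (a * x), (a * y).
    by rewrite mulrDr; split; [exact: IZ | exact: JZ |].
- by [].
by apply: (Hn n mn) => x Hx; apply: IJn; [exists x, 0 | exists 0, x];
  rewrite ?addr0 ?add0r.
Qed.

(** If a maximal [n] contained I and J, then [n w], hence [I w], would lie in r. So [w] would be in
    J, thus in [n], although it is 1 modulo [n]. *)
Lemma top_ann_coann_comaximal : exists i j, [/\ top_ann i, top_coann j & 1 = i + j].
Proof.
apply: ideals_comaximal; [exact: top_ann_ideal | exact: top_coann_ideal |].
move=> n mn In Jn; have [w [n1w nw _]] := maximal_complement artA mn.
by apply: (maximal_not1 mn n1w); apply: Jn => b /In /nw.
Qed.

(** The element [w] of [maximal_complement] is not in I: otherwise every [w a w] is in r, and so is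
    [w]. Hence some class is not killed by [w], and its multiple by [w] is killed by [n]. *)
Lemma top_simple (n : A -> Prop) :
  maximal_left_ideal n -> (forall a, top_ann a -> n a) ->
  exists i (x : P (i + 1 + 1)), [/\ top_cycle x, ~ top_boundary x &
    forall a, n a -> top_boundary (a *: x)].
Proof.
move=> mn In; have [w [n1w nw _]] := maximal_complement artA mn.
have nIw : ~ top_ann w.
  move=> Iw; apply: (maximal_not1 mn n1w).
  have rw : jac w by apply: jac_semiprime => a; apply: nw; apply: In; exact: top_annMr.
  exact: rw.
have [i [x [Bx nCx]]] : exists i (x : P i), top_cycle x /\ ~ top_boundary (w *: x).
  apply: contrapT => noix; apply: nIw => i x Bx; apply: contrapT => nC.
  by apply: noix; exists i, x.
have : exists x : P i, top_cycle x /\ ~ top_boundary (w *: x) by exists x.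
(* The degree is written as [i + 1 + 1] so that the two preceding differentials can be named without
   casts. *)
rewrite -(subrK 1 i) -(subrK 1 (i - 1)) => {Bx nCx} [[y [By nCy]]].
exists (i - 1 - 1), (w *: y); split=> //; first exact: top_cycleZ.
by move=> a na; rewrite scalerA; apply/rad_top_boundary/rad_modZ; exact: nw.
Qed.

(** A form separating [q = x - d rho x] is composed with [1 - d rho], which sends boundaries into
    the radical and, by [defect_kill], kills [d (rP)]. *)
Lemma top_form (n : A -> Prop) i (x : P (i + 1)) :
  maximal_left_ideal n -> ~ top_boundary x -> (forall a, n a -> top_boundary (a *: x)) ->
  exists Phi : {linear P (i + 1) -> A^o},
    [/\ n (Phi x - 1), forall z, jac (Phi (d i z)) &
        forall z, rad_mod z -> Phi (d i z) = 0].
Proof.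
move=> mn nCx nC; have [rho Hrho] := qinvP i.
pose q := x - d i (rho x).
have [||phi nphi] := @separating_form A (P (i + 1)) n q (fgP _) (@projP _) mn.
- move=> rq; apply: nCx; exists (d i (rho x)), q; split=> //.
  by rewrite [RHS]addrC subrK.
- move=> a na; have [z [y [dz ry axE]]] := nC a na.
  have -> : a *: q = (z - d i (rho z)) + (y - d i (rho y)).
    rewrite scalerBr axE; have -> : a *: d i (rho x) = d i (rho (a *: x)).
      by rewrite linearZ /= linearZ.
    by rewrite axE linearD /= linearD /= opprD addrACA.
  move/exactP: dz => [z' <-]; apply: rad_modD; first exact: Hrho.
  by apply: rad_modB => //; do 2!apply: rad_mod_map.
have lin_Phi : linear (fun z => phi (z - d i (rho z))).
  move=> a z z'; rewrite -linearP; congr (phi _).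
  by rewrite linearP /= linearP scalerBr opprD addrACA.
exists (linear_of lin_Phi); split=> //= z; first by apply: rad_mod_form; exact: Hrho.
by move=> rz; rewrite -(defect_kill Hrho rz) subrr linear0.
Qed.

(** * Vanishing of I r J and J r I *)

(** The right annihilator [K] of I r contains r. Once [I + K = A], J lies in [JI + K], which is
    inside [K]. *)
Lemma ann_rad_coann a s b : top_ann a -> jac s -> top_coann b -> a * s * b = 0.
Proof.
pose K w := forall a s, top_ann a -> jac s -> a * s * w = 0.
have lK : left_ideal K.
  split=> [a' s' _ _|w w' Kw Kw' a' s' Ia rs|c w Kw a' s' Ia rs].
  - by rewrite mulr0.
  - by rewrite mulrDr Kw // Kw' // addr0.
  - by rewrite mulrA -(mulrA a') Kw //; exact: jacMr.
have rK t : jac t -> K t by move=> rt a' s' _ rs; rewrite -mulrA (rad2 rs rt) mulr0.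
have [i [k [Ii Kk E1]]] : exists i k, [/\ top_ann i, K k & 1 = i + k].
  apply: ideals_comaximal => //; first exact: top_ann_ideal.
  move=> n mn In Kn; have [i [x [Bx nCx nx]]] := top_simple mn In.
  have [Phi [nPhi _ Phi0]] := top_form mn nCx nx.
  have nPx : n (Phi x).
    apply: Kn => a' s' Ia rs.
    (* This is the connecting map: [s' *: x] is a true cycle, so it is [d x'] with [x'] a cycle
       modulo the radical. As [a'] makes [x'] a boundary modulo the radical, [a' s' x] is in
       [d (rP)], where [Phi] vanishes. *)
    have dsx : d (i + 1 + 1) (s' *: x) = 0 by rewrite linearZ /=; exact: rad_mod_kill.
    have [x' dx'] := (exactP _).1 dsx.
    have [z [y [dz ry axE]]] : top_boundary (a' *: x').
      by apply: Ia; rewrite /top_cycle dx'; exact: rad_modZ.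
    have <- : Phi (a' *: (s' *: x)) = a' * s' * Phi x :> A.
      by rewrite scalerA linearZ.
    by rewrite -dx' -linearZ /= axE linearD /= dz add0r Phi0.
  apply: (maximal_not1 mn _ nPx); rewrite -opprB.
  by apply: (submodN (M := A^o)) => //; case: mn.
move=> Ia rs Jb; have [_ KD KZ] := lK.
suff Kb : K b by exact: Kb.
rewrite -[b]mulr1 E1 mulrDr; apply: KD; last exact: KZ.
by apply: rK; exact: top_coann_ann.
Qed.

(** With [K] the right annihilator of J r, it suffices that [J + K = A]. Otherwise a maximal [m]
    contains both; a simple left ideal [A y] inside r, killed by I, then leads to a class in the
    next degree that contradicts the choice of [w]. *)
Lemma coann_rad_ann a s b : top_coann a -> jac s -> top_ann b -> a * s * b = 0.
Proof.
pose K w := forall a s, top_coann a -> jac s -> a * s * w = 0.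
have lK : left_ideal K.
  split=> [a' s' _ _|w w' Kw Kw' a' s' Ia rs|c w Kw a' s' Ia rs].
  - by rewrite mulr0.
  - by rewrite mulrDr Kw // Kw' // addr0.
  - by rewrite mulrA -(mulrA a') Kw //; exact: jacMr.
have rK t : jac t -> K t by move=> rt a' s' _ rs; rewrite -mulrA (rad2 rs rt) mulr0.
have [j [k [Jj Kk E1]]] : exists j k, [/\ top_coann j, K k & 1 = j + k].
  apply: ideals_comaximal => //; first exact: top_coann_ideal.
  move=> m mm Jm Km; have [w [m1w mw wm]] := maximal_complement artA mm.
  have mw' : ~ m w := maximal_not1 mm m1w.
  have [j [s' [Jj rs' jsw]]] : exists j s', [/\ top_coann j, jac s' & j * s' * w <> 0].
    apply: contrapT => nojs; apply: mw'; apply: Km => j s' Jj rs'.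
    by apply: contrapT => jsw; apply: nojs; exists j, s'.
  have sub0 : submod (fun x : A^o => x = 0).
    by split=> [//|x y -> ->|c x ->]; rewrite ?addr0 ?scaler0.
  have [l [ny mn]] := simple_below artA sub0 jsw.
  pose y : A := l * (j * s' * w); pose n c := c * y = 0.
  have {}mn : maximal_left_ideal n := mn.
  have {}ny : y <> 0 := ny.
  have rl : jac (l * (j * s')) by do 2!apply: jacMl.
  have ry : jac y by rewrite /y mulrA; exact: jacMr.
  (* Modulo r, [w] is idempotent, as [(1 - w) w] is in [m w]; a left factor in r makes this an
     equality. *)
  have yw : y * w = y.
    have -> : y * w = y - l * (j * s') * ((1 - w) * w).
      by rewrite mulrBl mul1r mulrBr opprB addrC /y !mulrA subrK.
    by rewrite rad2 ?subr0 //; exact: mw.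
  have In c : top_ann c -> n c.
    move=> Ic; rewrite /n /y; have -> : c * (l * (j * s' * w)) = (c * l * j) * (s' * w).
      by rewrite !mulrA.
    by apply: rad2; [apply: Jj; exact: top_annMr | exact: jacMr].
  have [i [x [Bx nCx nx]]] := top_simple mn In.
  have [Phi [nPhi rPhi _]] := top_form mn nCx nx.
  (* [Phi] maps boundaries into r, which kills [y]; so this form vanishes on boundaries and factors
     as [theta d]. *)
  have lin_f : linear (fun z => (Phi z : A) * y : A^o).
    by move=> c z z'; rewrite linearP /= mulrDl -mulrA.
  have [_ _ homP] := totP.
  have [|theta Hth] := (homP _ (linear_of lin_f)).1.
    by move=> z /=; apply: rad2.
  have thx : theta (d _ x) = y.
    rewrite -Hth /=; apply/eqP; rewrite -subr_eq0 -[X in _ - X]mul1r -mulrBl.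
    exact/eqP.
  have [rho Hrho] := qinvP (i + 1 + 1 + 1).
  have th0 z : (forall p : P (i + 1 + 1 + 1), top_cycle p -> jac (theta p * w : A)) ->
      rad_mod z -> theta (z - rho (d _ z)) * w = 0 :> A.
    move=> Hp; elim=> [|t p z' rt _ IH]; first by rewrite linear0 /= linear0 addrN linear0 mul0r.
    have -> : t *: p + z' - rho (d _ (t *: p + z')) =
              t *: (p - rho (d _ p)) + (z' - rho (d _ z')).
      by rewrite linearP /= linearP scalerBr opprD addrACA.
    rewrite linearP /= mulrDl IH addr0 -mulrA; apply: rad2 => //; apply: Hp.
    by rewrite /top_cycle linearB; exact: Hrho.
  (* Otherwise [th0] applies to [d x], a true cycle in the radical, and gives [theta (d x) * w = 0],
     whereas this is [y w = y]. *)
  have [p [Bp nrp]] : exists p : P (i + 1 + 1 + 1),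
      top_cycle p /\ ~ jac (theta p * w : A).
    apply: contrapT => nop; apply: ny; rewrite -yw -thx.
    have := th0 _ _ Bx; rewrite dd linear0 subr0; apply => p Bp.
    by apply: contrapT => nrp; apply: nop; exists p.
  (* I sends [p] into boundaries plus radical, where [theta] takes values in r. So [theta p * w] is
     in J, hence in [m], hence in r. *)
  apply: nrp; apply: wm; apply: Jm => c Ic.
  have [z [z' [dz rz' cpE]]] := Ic _ _ Bp.
  have -> : c * (theta p * w) = (theta (c *: p) : A) * w by rewrite linearZ -mulrA.
  apply: jacMr; rewrite cpE linearD; apply: jacD; last exact: rad_mod_form.
  by move/exactP: dz => [z0 <-]; rewrite -Hth; exact: jacMl.
move=> Ja rs Ib; have [_ KD KZ] := lK.
suff Kb : K b by exact: Kb.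
rewrite -[b]mulr1 E1 mulrDr; apply: KD; last exact: KZ.
by apply: rK; apply: Jj.
Qed.

(** * The two extreme cases and Baer's criterion *)

(** A projection of [P 0] onto the kernel of [d 0] is built from [rho], making [M] a direct summand
    of [P 0]. *)
Lemma kernel_projective (M : lmodType A) (e : {linear M -> P 0}) :
  (forall i (x : P i), top_cycle x -> top_boundary x) ->
  injective e -> (forall x, d 0 x = 0 <-> exists m, e m = x) -> projective_mod M.
Proof.
move=> BC inj_e ker_e; have [rho Hrho] := qinvP (Negz 0).
(* [Negz 0 + 1] and [0] are convertible, which lets [d (-1)] land in [P 0]. *)
have [del [Hdel delE]] : exists del : {linear P 0 -> P 0},
    (forall x, exists y : P (Negz 0), d (Negz 0) y = del x) /\
    forall x, del x = d (Negz 0) (rho x).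
  have lin_del : linear (fun x : P 0 => d (Negz 0) (rho x) : P 0).
    by move=> a x y; rewrite linearP /= linearP.
  by exists (linear_of lin_del); split=> // x; exists (rho x).
have ker_del x : d 0 (del x) = 0 by apply: (exactP (i := Negz 0) _).2; exact: Hdel.
(* The defect [x - del x] is a cycle in the radical. With zero cohomology it is [d y] for some [y]
   in the radical, where [rho] is an exact quasi-inverse. *)
have defect2 x : d 0 x = 0 -> x - del x = del (x - del x).
  move=> dx; have [z dz] := (exactP (i := Negz 0) x).1 dx.
  have rx : rad_mod (x - del x) by rewrite delE -dz; exact: Hrho.
  have d0 : d 0 (x - del x) = 0 by rewrite linearB /= dx ker_del subrr.
  have [x' dx'] := (exactP (i := Negz 0) _).1 d0.
  have [z' [y [dz' ry x'E]]] : top_boundary x' by apply: BC; rewrite /top_cycle dx'.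
  rewrite [RHS]delE -dx' x'E linearD /= dz' add0r; exact: defect_kill.
(* This is [1 - (1 - del)^2]; on cycles [(1 - del)^2] vanishes by [defect2]. *)
pose kappa x := del x + (del x - del (del x)).
have kappaK x : d 0 x = 0 -> kappa x = x.
  by move=> /defect2; rewrite linearB /= => dx; rewrite /kappa -dx addrC subrK.
have ker_kappa x : exists m, e m = kappa x.
  apply/ker_e; rewrite /kappa linearD linearB /= !ker_del subrr addr0 //.
have [pi Hpi] := choice ker_kappa.
have lin_pi : linear pi.
  move=> a x y; apply: inj_e; rewrite linearP /= !Hpi /kappa (linearP del) (linearP del).
  rewrite opprD !scalerDr scalerN [in RHS]addrACA; congr (_ + _).
  by rewrite addrACA.
move=> N N' g f surj_g.
have [h Hh] := @projP 0 _ _ g (f \o linear_of lin_pi : {linear P 0 -> N'}) surj_g.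
exists (h \o e : {linear M -> N}) => m /=; rewrite Hh /=; congr (f _).
by apply: inj_e; rewrite Hpi kappaK //; apply/ker_e; exists m.
Qed.

(** [Phi] sends boundaries into r, inside [n], so [g] can be applied after [Phi d]. Acyclicity of
    [Hom(P, A)] extends the result to [Psi], and evaluating at [x] yields the multiplier. *)
Lemma maximal_extension (n : A -> Prop) (g : A -> A) :
  maximal_left_ideal n -> (forall a, top_ann a -> n a) ->
  (forall a x y, n x -> n y -> g (a * x + y) = a * g x + g y) ->
  exists c, forall a, n a -> g a = a * c.
Proof.
move=> mn In lin_g; have [[n0 nD nZ] nn1 _] := mn.
have [i [x0 [Bx0 nCx0 nx0]]] := top_simple mn In.
have [Phi [nPhi rPhi _]] := top_form mn nCx0 nx0.
have [rho Hrho] := qinvP (i + 1 + 1).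
(* The correction makes [a *: x] a true cycle, hence a boundary, for every [a] in [n]. *)
pose x := x0 - rho (d _ x0).
have dax a : n a -> d _ (a *: x) = 0.
  move=> na; have [z [y [dz ry axE]]] := nx0 a na.
  have -> : a *: x = a *: x0 - rho (d _ (a *: x0)).
    by rewrite /x scalerBr [d _ (a *: x0)]linearZ /= [rho (a *: _)]linearZ.
  rewrite linearB /= axE linearD /= dz add0r.
  by rewrite -(defect_kill Hrho ry) subrr.
have nt : n (Phi x - 1).
  rewrite /x linearB /= addrAC; apply: (submodB (M := A^o)) => //.
  have rPx : jac (Phi (rho (d _ x0))) by apply: rad_mod_form; exact: rad_mod_map.
  exact: rPx.
have lin_h : linear (fun z => g (Phi (d (i + 1) z)) : A^o).
  move=> a z z'; rewrite linearP /= linearP /=; apply: lin_g; exact: rPhi.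
have g0 : g 0 = 0.
  have /eqP := lin_g 1 0 0 n0 n0; rewrite !mul1r addr0.
  by rewrite -[X in X == _]addr0 (inj_eq (addrI _)) => /eqP.
have [_ _ homP] := totP.
have [|Psi HPsi] := (homP _ (linear_of lin_h)).1.
  by move=> z /=; rewrite dd linear0.
(* From [a Psi(x) = g (a Phi(x))]; the second term accounts for [Phi x] being 1 only modulo [n]. *)
exists (Psi x - g (Phi x - 1)) => a na.
have [z dz] := (exactP _).1 (dax a na).
have E : a * Psi x = g (a * Phi x).
  have : Psi (a *: x) = g (Phi (a *: x)) by rewrite -dz -HPsi.
  by rewrite !linearZ.
rewrite mulrBr E; have -> : a * Phi x = a * (Phi x - 1) + a :> A by rewrite mulrBr mulr1 subrK.
by rewrite lin_g // addrC addKr.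
Qed.

End TotallyAcyclic.

(** Maximal left ideals suffice: outside the domain [D] of a maximal partial extension,
    [simple_below] finds [x] whose class modulo [D] has a maximal annihilator. *)
Lemma baer_maximal (A : pzRingType) :
  artinian_mod A^o ->
  (forall (n : A -> Prop) (g : A -> A), maximal_left_ideal n ->
    (forall a x y, n x -> n y -> g (a * x + y) = a * g x + g y) ->
    exists c, forall a, n a -> g a = a * c) ->
  self_injective A.
Proof.
move=> artA ext N N' g f inj_g.
(* Partial maps are given by their graphs; for a linear graph the last clause means
   single-valued. *)
pose partial (G : set (N' * A)) :=
  [/\ forall n, G (g n, f n),
      forall a x u y v, G (x, u) -> G (y, v) -> G (a *: x + y, a * u + v) &
      forall u, G (0, u) -> u = 0].
have [||G [Gg GL G0] maxG] := @Zorn_above_bigcup (N' * A)%type partial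
    (fun p => exists n, p = (g n, f n)).
- split=> [n|a x u y v [n [-> ->]] [m [-> ->]]|u [n [E ->]]]; first by exists n.
    by exists (a *: n + m); rewrite !linearP.
  by rewrite (_ : n = 0) ?linear0 //; apply: inj_g; rewrite -E linear0.
- move=> F FP [X FX] Ftot; split.
  + by move=> n; exists X => //; case: (FP _ FX).
  + move=> a x u y v [Y FY Yx] [Z FZ Zy].
    case: (Ftot Y Z FY FZ) => sub; [exists Z => // | exists Y => //].
      by have [_ H _] := FP _ FZ; apply: H => //; exact: sub.
    by have [_ H _] := FP _ FY; apply: H => //; exact: sub.
  + by move=> u [Y FY Yu]; have [_ _ H] := FP _ FY; exact: H.
have G00 : G (0, 0) by have := Gg 0; rewrite !linear0.
have Gfun x u v : G (x, u) -> G (x, v) -> u = v.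
  move=> Gu Gv; apply/eqP; rewrite -subr_eq0; apply/eqP/G0.
  have := GL (-1) x v x u Gv Gu.
  by rewrite scaleN1r addNr mulN1r addrC.
pose D x := exists u, G (x, u).
have sD : submod D.
  split; first by exists 0.
    by move=> x y [u Gu] [v Gv]; exists (u + v);
      have := GL 1 x u y v Gu Gv; rewrite scale1r mul1r.
  by move=> a x [u Gu]; exists (a * u);
    have := GL a x u 0 0 Gu G00; rewrite !addr0.
have totD x0 : D x0.
  apply: contrapT => nDx0; have [l [nDx mn]] := simple_below artA sD nDx0.
  set x := l *: x0 in nDx mn.
  have [h Hh] : exists h : A -> A, forall a, D (a *: x) -> G (a *: x, h a).
    have [|h Hh] := @choice A A (fun a u => D (a *: x) -> G (a *: x, u)).
      move=> a; have [[u Gu]|nDa] := pselect (D (a *: x)); first by exists u.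
      by exists 0.
    by exists h.
  have [|c Hc] := ext _ h mn.
    move=> a b b' Db Db'; have G1 := GL a _ _ _ _ (Hh b Db) (Hh b' Db').
    rewrite scalerA -scalerDl in G1.
    by apply: (Gfun _ _ _ (Hh _ _) G1); exists (a * h b + h b').
  pose G' (p : N' * A) := exists y v a, G (y, v) /\ p = (y + a *: x, v + a * c).
  apply: nDx; exists c; apply: (maxG G').
  + split.
    * by move=> n; exists (g n), (f n), 0; rewrite scale0r mul0r !addr0.
    * move=> a y u z v [y1 [v1 [a1 [G1 [-> ->]]]]] [y2 [v2 [a2 [G2 [-> ->]]]]].
      exists (a *: y1 + y2), (a * v1 + v2), (a * a1 + a2); split; first exact: GL.
      by rewrite scalerDr mulrDr scalerA mulrA scalerDl mulrDl !(addrACA _ (_ *: x))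
        (addrACA _ (_ * c)).
    * move=> u [y [v [a [Gy [/eqP E ->]]]]].
      have Ey : y = - (a *: x) by apply/eqP; rewrite -addr_eq0 eq_sym.
      have Dax : D (a *: x).
        by rewrite -[a *: x]opprK -Ey; apply: submodN => //; exists v.
      have Gax := Hh a Dax; rewrite (Hc a Dax) in Gax.
      have := GL 1 _ _ _ _ Gy Gax.
      by rewrite scale1r mul1r Ey addNr; exact: G0.
  + by move=> [y v] Gy; exists y, v, 0; rewrite scale0r mul0r !addr0.
  + by exists 0, 0, 1; rewrite scale1r mul1r !add0r.
have [h Hh] := choice totD.
have lin_h : linear (h : N' -> A^o).
  by move=> a x y; apply: Gfun (Hh _) _; exact: GL.
by exists (linear_of lin_h) => n; apply: Gfun (Hh _) _; exact: Gg.
Qed.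

(** Expand [(i + j)^3 = 1] with [i], [j] commuting: the halves [j^2 (j + 3 i) = j^2 (1 + 2 i)] and
    [i^2 (1 + 2 j)] sum to 1, and their product contains [(i j)^2]. *)
Lemma idempotent_lift (A : pzRingType) (i j : A) :
  1 = i + j -> i * j * (i * j) = 0 ->
  exists a b, j * a + i * b = 1 /\ j * a * (i * b) = 0.
Proof.
move=> E1 sq0.
have cij : i * j = j * i.
  have -> : i = 1 - j by rewrite E1 addrK.
  by rewrite mulrBl mulrBr mul1r mulr1.
have jji : j * j * i = i * (j * j) by rewrite mulrA cij -!mulrA cij.
exists (j * (1 + i + i)), (i * (1 + j + j)); split.
  have s_split : j * j * i + i * i * j = i * j.
    by rewrite jji -(mulrA i i) -mulrDr -mulrDl addrC -E1 mul1r.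
  rewrite !(mulrA i i) !(mulrA j j) !mulrDr !mulr1 addrACA s_split.
  rewrite [X in X + _]addrACA s_split -[RHS]mulr1 {2}E1 mul1r.
  have -> : i + j = (i + j) * (i + j) by rewrite -E1 mulr1.
  rewrite mulrDl !mulrDr -cij (addrC (j * j)) [in RHS]addrA [RHS]addrC !addrA.
  by rewrite [in LHS](addrC (i * i)).
have sq0' : j * j * i * i = 0 by rewrite jji -!mulrA -cij mulrA.
have cu : (1 + i + i) * i = i * (1 + i + i) by rewrite !mulrDl !mulrDr mul1r mulr1.
move: (1 + i + i) cu => u cu; rewrite !mulrA -(mulrA (j * j) u) cu mulrA.
by rewrite -(mulrA (j * j * i) u) cu mulrA sq0' !mul0r.
Qed.

Theorem theorem2p3p9 (R : comPzRingType) (A : algType R) :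
  artin_algebra A ->
  connected_ring A ->
  radical_square_zero A ->
  self_injective A \/ CM_free A.
Proof.
move=> [artR fgA] [_ conn] rad2.
have artA : artinian_mod (A : pzRingType)^o.
  (* Left ideals are [R]-submodules, as [a *: x = (a *: 1) * x], so the chain condition descends
     from [R]. *)
  have artRA : artinian_mod (A : lmodType R) := artinian_fin_gen artR fgA.
  move=> L sL; apply: artRA => n; have [L0 LD LZ] := sL n; split=> // a x Lx.
  by rewrite -[x]mul1r scalerAl; exact: LZ.
have [|/existsNP[M /not_implyP[_ /not_implyP[gpM nprojM]]]] := pselect (CM_free A).
  by right.
case: gpM => P [d [totP [e [inj_e ker_e]]]]; left.
have [i [j [Ii Jj E1]]] := top_ann_coann_comaximal artA d.
have [|a [b [Eab ab0]]] := idempotent_lift E1.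
  by apply: rad2; exact: Jj.
set u := j * a in Eab ab0; set v := i * b in Eab ab0.
have Ju : top_coann d u by exact: top_coannMr.
have Iv : top_ann d v by exact: top_annMr.
clearbody u v.
have uu : u * u = u by rewrite -[RHS]mulr1 -Eab mulrDr ab0 addr0.
have vv : v * v = v by rewrite -[RHS]mul1r -Eab mulrDl ab0 add0r.
(* The element [u c v] is in JI, inside r; framed by the idempotents it lies in J r I. With [vcu]
   this makes [u] central. *)
have ucv c : u * c * v = 0.
  have -> : u * c * v = u * (u * c * v) * v by rewrite !mulrA uu -!mulrA vv.
  apply: (coann_rad_ann artA rad2 totP) => //.
  by apply: top_coann_ann Iv; exact: top_coannMr.
have vcu c : v * c * u = 0.
  have -> : v * c * u = v * (v * c * u) * u by rewrite !mulrA vv -!mulrA uu.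
  apply: (ann_rad_coann artA rad2 totP) => //.
  by apply: Ju; exact: top_annMr.
have [] := conn u uu.
- move=> c; rewrite -[LHS]mulr1 -Eab mulrDr ucv addr0.
  by rewrite -[RHS]mul1r -Eab mulrDl !mulrA vcu addr0.
- move=> u0; case: nprojM; apply: (kernel_projective artA rad2 totP _ inj_e ker_e).
  (* Here [v = 1] lies in I, so the cohomology of [P / rP] is zero. *)
  move=> k x Bx; rewrite -[x]scale1r -Eab u0 add0r; exact: Iv.
- move=> u1; apply: (baer_maximal artA) => n g mn.
  apply: (maximal_extension artA rad2 totP mn).
  (* Here 1 lies in J, so I is inside r and thus in every maximal left ideal. *)
  move=> c Ic; have rc : jacobson_radical c by rewrite -[c]mulr1 -u1; exact: Ju.
  exact: rc.
Qed.
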